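(* Let $t\ge1$, let $\psi$ be a $\mathcal{C}^t_3$-formula, and let $A,B$ be sets of interpretations over finite linear orders such that $(A,B)\models\psi$. If $\delta$ is a minimal separator for $\langle A,B\rangle$, then $|\psi|\ge \frac{w(\delta)}{t}$.
   Context: Structures are finite linear orders of integers over the signature $\{min,max,<,succ\}$. An interpretation is $(\mathcal{A},\alpha)$ with $\mathcal{A}$ such a linear order and $\alpha$ an assignment of the variables $x,y,z$ to elements of $\mathcal{A}$; we write $\alpha(min)$, $\alpha(max)$ for the least and greatest elements of $\mathcal{A}$. $(A,B)\models\psi$ means every interpretation in $A$ satisfies $\psi$ and every interpretation in $B$ satisfies $\neg\psi$. Counting logic extends first-order logic by $\exists^{\ge k}x\,\varphi$ (at least $k$ distinct values of $x$ satisfy $\varphi$) and $\forall^{\ge k}x\,\varphi:=\neg\exists^{\ge k}x\,\neg\varphi$; $\mathcal{C}^t_3$ is the fragment using only variables $x,y,z$ with all counting quantifiers having $k\le t$. Size: atomic $=1$, $|\neg\varphi|=|\varphi|+1$, $|\varphi\vee\psi|=|\varphi\wedge\psi|=|\varphi|+|\psi|$, $|Q^{\ge k}x\,\varphi|=|\varphi|+1$. For integers $a,b$, $d(a,b):=|a-b|$ and $<$-type$(a,b)\in\{=,<,>\}$ records the order between $a$ and $b$. Let $\mathcal{P}_2(V)$ be the set of 2-element subsets of $V=\{min,max,x,y,z\}$. A separator is a map $\delta:\mathcal{P}_2(V)\to\mathbb{N}$; it is a separator for $\langle A,B\rangle$ if for every $(\mathcal{A},\alpha)\in A$ and $(\mathcal{B},\beta)\in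 B$ there are $u\ne u'$ in $V$ with either $<$-type$(\alpha(u),\alpha(u'))\ne<$-type$(\beta(u),\beta(u'))$, or both $\min[d(\alpha(u),\alpha(u')),d(\beta(u),\beta(u'))]\le\delta(\{u,u'\})$ and $d(\alpha(u),\alpha(u'))\ne d(\beta(u),\beta(u'))$. The border-distance is $b(\delta):=\max\{\delta(\{min,max\}),\ \delta(\{min,u\})+\delta(\{u',max\}) : u,u'\in\{x,y,z\}\}$, the centre-distance is $c(\delta):=\max\{\delta(p)+\delta(q): p,q\in\mathcal{P}_2(\{x,y,z\}), p\ne q\}$, and the weight is $w(\delta):=\sqrt{c(\delta)^2+b(\delta)}$. A minimal separator for $\langle A,B\rangle$ is a separator for $\langle A,B\rangle$ of minimal weight.
   Formalization: The universes of the linear orders are taken to be intervals of consecutive integers, so that |a-b| is the succ-distance; for orders with gaps the claim fails (succ(min,max), of size 1, separates {0,1000} from {0,...,999}, but every separator has weight above 31). *)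

(* Defs.v *)
From HB Require Import structures.
From mathcomp Require Import all_boot all_order all_algebra.
Set Implicit Arguments.
Unset Strict Implicit.
Unset Printing Implicit Defensive.
Import Order.TTheory GRing.Theory Num.Theory.
Local Open Scope ring_scope.

Inductive var := X | Y | Z.

Definition var_enc (v : var) : option bool :=
  match v with X => None | Y => Some false | Z => Some true end.
Definition var_dec (o : option bool) : var :=
  match o with None => X | Some false => Y | Some true => Z end.
Lemma var_encK : cancel var_enc var_dec. Proof. by case. Qed.
HB.instance Definition _ := Finite.copy var (can_type var_encK).

(* The signature has no function symbols of positive arity, so the five
   elements of V = {min, max, x, y, z} are exactly the terms. *)
Inductive term := Min | Max | Var of var.

Definition term_enc (u : term) : bool + var :=
  match u with Min => inl false | Max => inl true | Var v => inr v end.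
Definition term_dec (s : bool + var) : term :=
  match s with inl false => Min | inl true => Max | inr v => Var v end.
Lemma term_encK : cancel term_enc term_dec. Proof. by do 2?case. Qed.
HB.instance Definition _ := Finite.copy term (can_type term_encK).

(* A finite linear order is an interval lo, lo + 1, ..., hi of the integers:
   the integer distance |a - b| is then the distance along succ. *)
Record linord := LinOrd { lo : int; hi : int; lo_le_hi : lo <= hi }.

Definition elt (L : linord) := {i : int | lo L <= i <= hi L}.

Lemma min_subproof (L : linord) : lo L <= lo L <= hi L.
Proof. by rewrite lexx lo_le_hi. Qed.
Lemma max_subproof (L : linord) : lo L <= hi L <= hi L.
Proof. by rewrite lexx lo_le_hi. Qed.

Definition min_elt (L : linord) : elt L := exist _ (lo L) (min_subproof L).
Definition max_elt (L : linord) : elt L := exist _ (hi L) (max_subproof L).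

Definition eval (L : linord) (alpha : var -> elt L) (u : term) : elt L :=
  match u with
  | Min => min_elt L
  | Max => max_elt L
  | Var v => alpha v
  end.

Definition update (L : linord) (alpha : var -> elt L) (v : var) (a : elt L) :
  var -> elt L := fun v' => if v' == v then a else alpha v'.

Record interp := Interp { order_of : linord; asg : var -> elt order_of }.

(* [Exists 1] and [Forall 1] are the first-order quantifiers. [Forall] is a
   constructor, not an abbreviation, because its size is that of [Exists]. *)
Inductive formula :=
| Equal of term & term
| Less of term & term
| Succ of term & term
| Neg of formula
| Or of formula & formula
| And of formula & formula
| Exists of nat & var & formula
| Forall of nat & var & formula.

Fixpoint in_C3 (t : nat) (phi : formula) : bool :=
  match phi with
  | Equal _ _ | Less _ _ | Succ _ _ => true
  | Neg f => in_C3 t f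
  | Or f g | And f g => in_C3 t f && in_C3 t g
  | Exists k _ f | Forall k _ f => (k <= t)%N && in_C3 t f
  end.

Fixpoint fsize (phi : formula) : nat :=
  match phi with
  | Equal _ _ | Less _ _ | Succ _ _ => 1
  | Neg f => (fsize f).+1
  | Or f g | And f g => (fsize f + fsize g)%N
  | Exists _ _ f | Forall _ _ f => (fsize f).+1
  end.

Definition at_least (T : eqType) (k : nat) (P : T -> Prop) : Prop :=
  exists s : seq T, [/\ uniq s, size s = k & forall a, a \in s -> P a].

Fixpoint sat (L : linord) (alpha : var -> elt L) (phi : formula) : Prop :=
  match phi with
  | Equal u v => eval alpha u = eval alpha v
  | Less u v => val (eval alpha u) < val (eval alpha v)
  | Succ u v => val (eval alpha v) = val (eval alpha u) + 1
  | Neg f => ~ sat alpha f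
  | Or f g => sat alpha f \/ sat alpha g
  | And f g => sat alpha f /\ sat alpha g
  | Exists k v f => at_least k (fun a => sat (update alpha v a) f)
  | Forall k v f => ~ at_least k (fun a => ~ sat (update alpha v a) f)
  end.

Definition satI (I : interp) (phi : formula) : Prop := sat (@asg I) phi.

Definition separates (A B : interp -> Prop) (phi : formula) : Prop :=
  (forall I, A I -> satI I phi) /\ (forall J, B J -> satI J (Neg phi)).

Definition valI (I : interp) (u : term) : int := val (eval (@asg I) u).

Definition dist (a b : int) : nat := `|a - b|%N.

Definition lt_type (a b : int) : comparison :=
  if a == b then Eq else if a < b then Lt else Gt.

Definition P2 := {p : {set term} | #|p| == 2}.

Lemma upair_subproof (u v : term) : u != v -> #|[set u; v]| == 2.
Proof. by rewrite cards2 => ->. Qed.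

Definition upair (u v : term) (uv : u != v) : P2 :=
  exist _ [set u; v] (upair_subproof uv).

Definition separator := P2 -> nat.

Definition is_separator (A B : interp -> Prop) (delta : separator) : Prop :=
  forall I J, A I -> B J ->
  exists (u u' : term) (uu' : u != u'),
    lt_type (valI I u) (valI I u') <> lt_type (valI J u) (valI J u') \/
    ((minn (dist (valI I u) (valI I u')) (dist (valI J u) (valI J u'))
        <= delta (upair uu'))%N /\
     dist (valI I u) (valI I u') <> dist (valI J u) (valI J u')).

Definition border (delta : separator) : nat :=
  maxn (delta (@upair Min Max isT))
       (\max_(u : var) \max_(u' : var)
          (delta (@upair Min (Var u) isT) + delta (@upair (Var u') Max isT))).

Definition is_var_pair (p : P2) : bool := val p \subset [set Var v | v : var].

Definition centre (delta : separator) : nat :=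
  \max_(p : P2 | is_var_pair p)
    \max_(q : P2 | is_var_pair q && (p != q)) (delta p + delta q).

Definition weight (R : rcfType) (delta : separator) : R :=
  Num.sqrt ((centre delta)%:R ^+ 2 + (border delta)%:R).

Definition minimal_separator (R : rcfType) (A B : interp -> Prop)
    (delta : separator) : Prop :=
  is_separator A B delta /\
  forall delta' : separator, is_separator A B delta' ->
    weight R delta <= weight R delta'.

(* Main.v *)
Require Import Defs.
From mathcomp Require Import all_boot all_order all_algebra.
From mathcomp Require Import zify.
Set Implicit Arguments.
Unset Strict Implicit.
Unset Printing Implicit Defensive.
Import Order.TTheory GRing.Theory Num.Theory.
Local Open Scope ring_scope.

(** By induction on a formula of size s one finds a separator, of weight at most
t * s, for its models against its countermodels; a minimal separator can only be
lighter. Conjunction and disjunction take pointwise maxima, under which weights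
are subadditive, so everything happens at the quantifiers.

A table D bounds, for each pair of terms, how much of their signed difference a
formula can see: exactly if it is less than D in absolute value, only its sign
otherwise, and nothing at all if D = 0. The induced separator is D - 1.
Eliminating a quantified x from D needs the entry D(u,x) + D(v,x) + kap at (u,v):
the elements of an order between u and v that are far from both then either have
enough far counterparts in the other order, or u and v are equally far apart in
both orders and the element can be translated.

For t >= 2 take kap = 2t - 3 and charge D + t - 2 for a pair of variables with
D > 0; c^2 + b <= (t s)^2 is preserved. For t = 1 take kap = 0 and charge D. This
only fails for the atoms succ(u,v) between variables, where D = 2 but s = 1, so
these are kept apart from D until the next quantifier. If x and y are then linked
by a single such atom and D(x,y) = 0, that atom concerns one element y + 1 or
y - 1 only, which costs less than putting D(x,y) = 2. *)

(** * Comparing integers up to a threshold *)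

Definition close (d : nat) (i j : int) : bool :=
  [|| d == 0%N, i == j, (d%:Z <= i) && (d%:Z <= j)
    | (i <= - d%:Z) && (j <= - d%:Z)].

Lemma close_sym d i j : close d i j = close d j i.
Proof. by rewrite /close; lia. Qed.

Lemma close_opp d i j : close d (- i) (- j) = close d i j.
Proof. by rewrite /close; lia. Qed.

Lemma close_le d e i j : (d <= e)%N -> close e i j -> close d i j.
Proof. by rewrite /close; lia. Qed.

(** * Counterparts of a single element *)

Section Zone.

Variables (T : finType) (anc : pred T) (mn mx : T) (p q : T -> int).
Variables (r : T -> nat) (k kap : nat) (a : int).

Hypothesis anc_mn : anc mn.
Hypothesis anc_mx : anc mx.
Hypothesis p_range : forall u, anc u -> p mn <= p u <= p mx.
Hypothesis q_range : forall u, anc u -> q mn <= q u <= q mx.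
Hypothesis pq_close : forall u v, anc u -> anc v ->
  close (r u + r v + kap) (p v - p u) (q v - q u).
Hypothesis k_gt0 : (0 < k)%N.
Hypothesis k_kap : (k <= kap.+1)%N.
Hypothesis a_range : p mn <= a <= p mx.

Definition counterpart (a' : int) : Prop :=
  (q mn <= a' <= q mx) /\
  forall u, anc u -> close (r u) (a - p u) (a' - q u).

(* The bounds on the distances make translation injective if 2 * k <= kap + 3. *)
Definition rigid_at (l u : T) : Prop :=
  [/\ anc l, anc u, q l - p l = q u - p u,
      `|a - p l| + 2 <= (r l + k)%:Z /\ `|p u - a| + 2 <= (r u + k)%:Z
    & (- (r l)%:Z < a - p l \/ l = mn) /\ (- (r u)%:Z < p u - a \/ u = mx)].

(** If [a] is nearer than [r u] to some anchor [u], translation along [u] works. Otherwise [a] lies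
    in a gap between the protected zones of two anchors, and every point of the image gap is a
    counterpart. Either the image gap has [k] points, or both gaps are equally long and translation
    stays inside. *)
Lemma zone :
  (exists L : int, forall a', L <= a' < L + k%:Z -> counterpart a') \/
  (exists l u, rigid_at l u /\ counterpart (a + (q l - p l))).
Proof.
case: (pickP [pred u | anc u & `|a - p u| < (r u)%:Z]) => [u /= /andP[au nu]|far].
  right; exists u, u; split; first by split=> //; lia.
  split=> [|v av].
    have := pq_close au anc_mn; have := pq_close au anc_mx.
    have := q_range au; have := p_range au; have := q_range anc_mx.
    by rewrite /close; lia.
  by have := pq_close au av; rewrite /close; lia.
have farP u : anc u -> (r u)%:Z <= `|a - p u|.
  by move=> au; have /= := far u; rewrite au /=; lia.
(* Anchors of radius 0 constrain nothing, so only the ends are kept among them. If both radii and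
   [kap] vanish, the gap is then the whole order, which has a point. *)
pose PL := [pred u | [&& anc u, (u == mn) || (0 < r u)%N & p u + (r u)%:Z <= a]].
pose PR := [pred u | [&& anc u, (u == mx) || (0 < r u)%N & a <= p u - (r u)%:Z]].
have PLmn : PL mn by rewrite /= anc_mn eqxx /=; have := farP _ anc_mn; lia.
have PRmx : PR mx by rewrite /= anc_mx eqxx /=; have := farP _ anc_mx; lia.
case: (Order.TotalTheory.arg_maxP (fun u => p u + (r u)%:Z) PLmn) => l /and3P[al l0 la] lmax.
case: (Order.TotalTheory.arg_minP (fun u => p u - (r u)%:Z) PRmx) => u /and3P[au u0 ua] umin.
(* The zone of any other anchor on the left ends no later than that of [l], and closeness carries
   this to the images; likewise on the right with [u]. *)
have img a' : q l + (r l)%:Z <= a' <= q u - (r u)%:Z -> counterpart a'.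
  move=> a'lu; split.
    by have := q_range al; have := q_range au; lia.
  move=> v av; case: (posnP (r v)) => [->|rv]; first by rewrite /close eqxx.
  have := farP _ av; have [pva|pva] := lerP (p v) a => fv.
    have /lmax : PL v by rewrite /= av rv orbT /=; lia.
    by have := pq_close av al; rewrite /close; lia.
  have /umin : PR v by rewrite /= av rv orbT /=; lia.
  by have := pq_close av au; rewrite /close; lia.
have [eq_d|neq_d] := eqVneq (p u - p l) (q u - q l); last first.
  (* Distances that differ are both at least [r l + r u + kap], which leaves [kap + 1 >= k] points
     in the image gap. *)
  left; exists (q l + (r l)%:Z) => a' a'L; apply: img.
  have := pq_close al au; move/eqP: neq_d => neq_d.
  have := q_range au; have := p_range au; have := q_range al.
  rewrite /close.
  by case/orP: l0 => [/eqP l0|l0]; case/orP: u0 => [/eqP u0|u0]; subst; lia.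
have [zk|zk] := leP (q l + (r l)%:Z + k%:Z) (q u - (r u)%:Z + 1).
  by left; exists (q l + (r l)%:Z) => a' a'L; apply: img; lia.
right; exists l, u; split; last by apply: img; lia.
split=> //; [lia|by split; lia|].
split.
  by case/orP: l0 => [/eqP ->|]; [right|left; lia].
by case/orP: u0 => [/eqP ->|]; [right|left; lia].
Qed.

End Zone.

(** * Tables and similar interpretations *)

Definition upd (I : interp) (x : var) (a : elt (order_of I)) : interp :=
  Interp (update (@asg I) x a).

Lemma valI_upd I x a u :
  valI (@upd I x a) u = if u == Var x then val a else valI I u.
Proof.
case: u => [||v] //; rewrite /valI /= /update.
have -> : (Var v == Var x) = (v == x) by apply/eqP/eqP => [[]|->].
by case: eqP.
Qed.

Lemma valI_range I u : valI I Min <= valI I u <= valI I Max.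
Proof. exact: (valP (eval (@asg I) u)). Qed.

Lemma ex_elt I (z : int) :
  valI I Min <= z <= valI I Max -> exists a : elt (order_of I), val a = z.
Proof. by move=> zI; exists (exist _ z zI). Qed.

Lemma elt_range I (a : elt (order_of I)) : valI I Min <= val a <= valI I Max.
Proof. exact: valP a. Qed.

Definition sim (D : term -> term -> nat) (I J : interp) : bool :=
  [forall u, forall v, close (D u v) (valI I v - valI I u) (valI J v - valI J u)].

Lemma simP D I J :
  reflect (forall u v, close (D u v) (valI I v - valI I u) (valI J v - valI J u))
          (sim D I J).
Proof.
apply: (iffP forallP) => [h u v|h u]; first exact: (forallP (h u)).
by apply/forallP=> v.
Qed.

Lemma sim_sym D I J : sim D I J = sim D J I.
Proof. by apply/simP/simP => h u v; rewrite close_sym. Qed.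

Lemma sim_le D E I J : (forall u v, (D u v <= E u v)%N) -> sim E I J -> sim D I J.
Proof. by move=> DE /simP h; apply/simP=> u v; apply: close_le (h u v). Qed.

Definition succI (I : interp) (p : var * var) : bool :=
  valI I (Var p.2) == valI I (Var p.1) + 1.

Definition agree (Sig : seq (var * var)) (I J : interp) : bool :=
  all (fun p => succI I p == succI J p) Sig.

Lemma agree_sym Sig I J : agree Sig I J = agree Sig J I.
Proof. by apply: eq_all => p; rewrite eq_sym. Qed.

Lemma agree_cat Sig1 Sig2 I J :
  agree (Sig1 ++ Sig2) I J = agree Sig1 I J && agree Sig2 I J.
Proof. exact: all_cat. Qed.

Definition preserved D Sig phi : Prop :=
  forall I J, sim D I J -> agree Sig I J -> satI I phi -> satI J phi.

(** This is weaker than a bijection: all [k] elements of [s'] may correspond to one element of [s],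
    as happens when that element has an interval of counterparts. *)
Definition matching (k : nat) (x : var) (E : interp -> interp -> Prop) I J :=
  forall s : seq (elt (order_of I)), uniq s -> size s = k ->
  exists s' : seq (elt (order_of J)), [/\ uniq s', size s' = k &
    forall a', a' \in s' -> exists2 a, a \in s & E (upd x a) (upd x a')].

Lemma matching_exists k x (E : interp -> interp -> Prop) phi I J :
    (forall K L, E K L -> satI K phi -> satI L phi) ->
  matching k x E I J -> satI I (Exists k x phi) -> satI J (Exists k x phi).
Proof.
move=> Ephi EIJ [s [us ss sphi]]; have [s' [us' ss' s's]] := EIJ s us ss.
exists s'; split=> // a' /s's [a /sphi sa /Ephi]; exact.
Qed.

(** A failure of [Forall] is a set of [k] counterexamples, so the matching runs from [J] back to
    [I]. *)
Lemma matching_forall k x (E : interp -> interp -> Prop) phi I J :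
    (forall K L, E K L -> satI L phi -> satI K phi) ->
  matching k x E J I -> satI I (Forall k x phi) -> satI J (Forall k x phi).
Proof.
move=> Ephi EJI nI [s [us ss sphi]]; apply: nI.
have [s' [us' ss' s's]] := EJI s us ss; exists s'; split=> // a' /s's [a as_ Eaa'] n.
by apply: (sphi _ as_); apply: Ephi Eaa' n.
Qed.

Lemma matching_point k x (E : interp -> interp -> Prop) I J : (k <= 1)%N ->
    (forall a : elt (order_of I), exists a' : elt (order_of J),
       E (upd x a) (upd x a')) ->
  matching k x E I J.
Proof.
case: k => [|[|//]] _ Ex [|a [|//]] //= us ss; first by exists [::].
have [a' Ea] := Ex a; exists [:: a']; split=> // b; rewrite inE => /eqP ->.
by exists a; rewrite ?inE.
Qed.

Lemma sim_upd D x I J (a : elt (order_of I)) (a' : elt (order_of J)) :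
    (forall u v, D u v = D v u) ->
    (forall u v, u != Var x -> v != Var x ->
       close (D u v) (valI I v - valI I u) (valI J v - valI J u)) ->
    (forall u, u != Var x ->
       close (D u (Var x)) (val a - valI I u) (val a' - valI J u)) ->
  sim D (upd x a) (upd x a').
Proof.
move=> Dsym h hx; apply/simP=> u v; rewrite !valI_upd.
case: eqVneq => [->|vx]; case: eqVneq => [->|ux].
- by rewrite !subrr /close eqxx orbT.
- exact: hx.
- by rewrite Dsym -close_opp !opprB; apply: hx.
- exact: h.
Qed.

(** * Eliminating a quantified variable *)

Definition anchor (D : term -> term -> nat) (x : var) (u : term) : bool :=
  (u != Var x) && [|| u == Min, u == Max | (0 < D u (Var x))%N].

Definition eliminates (D D' : term -> term -> nat) (x : var) (kap : nat) : Prop :=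
  forall u v, u != Var x -> v != Var x -> u != v ->
  (D u v <= D' u v)%N /\
  (anchor D x u -> anchor D x v -> D u (Var x) + D v (Var x) + kap <= D' u v)%N.

Section Anchors.

Variables (D D' : term -> term -> nat) (x : var) (kap : nat) (I J : interp).
Hypothesis Dsym : forall u v, D u v = D v u.
Hypothesis DD' : eliminates D D' x kap.
Hypothesis simIJ : sim D' I J.

Lemma eliminates_close u v : u != Var x -> v != Var x ->
  close (D u v) (valI I v - valI I u) (valI J v - valI J u).
Proof.
move=> ux vx; have [->|uv] := eqVneq u v; first by rewrite !subrr /close eqxx orbT.
by have [Duv _] := DD' ux vx uv; apply: close_le Duv (simP _ _ _ simIJ _ _).
Qed.

Lemma sim_counterpart (a : elt (order_of I)) (a' : elt (order_of J)) :
    counterpart (anchor D x) Min Max (valI I) (valI J) (fun u => D u (Var x))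
          (val a) (val a') ->
  sim D (upd x a) (upd x a').
Proof.
case=> _ im; apply: sim_upd => //; first exact: eliminates_close.
move=> u ux; have [Du|Du] := posnP (D u (Var x)); first by rewrite /close Du.
by apply: im; rewrite /anchor ux Du !orbT.
Qed.

(** The ends count as anchors even at radius 0, which bounds every gap on both sides and keeps
    counterparts inside the order. *)
Lemma anchors_zone k (a : elt (order_of I)) : (0 < k)%N -> (k <= kap.+1)%N ->
  let anc := anchor D x in let r u := D u (Var x) in
  (exists L : int, forall a', L <= a' < L + k%:Z ->
     counterpart anc Min Max (valI I) (valI J) r (val a) a') \/
  (exists l u, rigid_at anc Min Max (valI I) (valI J) r k (val a) l u /\
     counterpart anc Min Max (valI I) (valI J) r (val a)
           (val a + (valI J l - valI I l))).
Proof.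
move=> k_gt0 kkap anc r.
have cl u v : anc u -> anc v ->
    close (r u + r v + kap) (valI I v - valI I u) (valI J v - valI J u).
  move=> au av; have [->|uv] := eqVneq u v.
    by rewrite !subrr /close eqxx orbT.
  have /andP[ux _] := au; have /andP[vx _] := av.
  have [_ /(_ au av) le] := DD' ux vx uv.
  exact: close_le le (simP _ _ _ simIJ _ _).
apply: (zone _ _ _ _ cl k_gt0 kkap) => //; last exact: elt_range.
- by move=> u _; exact: valI_range.
- by move=> u _; exact: valI_range.
Qed.

(** If one element of [s] has [k] consecutive counterparts, these serve for the whole of [s].
    Otherwise every element is translated, possibly along different anchors, and the images stay
    distinct. *)
Lemma matching_eliminates k : (k <= kap.+1)%N -> (2 * k <= kap + 3)%N ->
  matching k x (fun K L => sim D K L) I J.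
Proof.
move=> kkap k2; have [->|k_gt0] := posnP k.
  by case=> // _ _; exists [::].
pose rigid (a : elt (order_of I)) (a' : elt (order_of J)) := exists l u,
  [/\ rigid_at (anchor D x) Min Max (valI I) (valI J) (fun u => D u (Var x)) k
        (val a) l u,
      counterpart (anchor D x) Min Max (valI I) (valI J) (fun u => D u (Var x))
        (val a) (val a')
    & val a' = val a + (valI J l - valI I l)].
(* A common image brings [l] and [l'] within [D(l,x) + D(l',x) + 2k - 4] of each other in [J]. This
   is below the entry of [D'] at them, so both anchors are shifted by the same amount. *)
have rigid_inj a b c : rigid a c -> rigid b c -> a = b.
  move=> [l [u [[al _ _ [al2 _] _] _ ca]]] [l' [u' [[al' _ _ [bl2 _] _] _ cb]]].
  apply: val_inj; have [ll'|ll'] := eqVneq l l'.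
    by subst l'; move: cb; rewrite ca; lia.
  have /andP[lx _] := al; have /andP[l'x _] := al'.
  have [_ /(_ al al') le] := DD' lx l'x ll'.
  have := simP _ _ _ simIJ l l'; rewrite /close; lia.
move=> s us ss.
have : (exists2 a, a \in s & exists L : int, forall a', L <= a' < L + k%:Z ->
     counterpart (anchor D x) Min Max (valI I) (valI J) (fun u => D u (Var x)) (val a) a') \/
   exists s' : seq (elt (order_of J)), [/\ uniq s', size s' = size s &
    forall a', a' \in s' -> exists2 a, a \in s & rigid a a'].
  elim: s us {ss} => [|a s IHs] /=; first by right; exists [::].
  move=> /andP[as_ /IHs [[b bs Lb]|[s' [us' ss' s's]]]].
    by left; exists b; rewrite // inE bs orbT.
  have [La|[l [u [rl im]]]] := anchors_zone a k_gt0 kkap.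
    by left; exists a; rewrite ?mem_head.
  have [a' va'] := ex_elt im.1; right; exists (a' :: s'); split=> /=.
  - rewrite us' andbT; apply/negP=> /s's [b bs rb].
    have ra : rigid a a' by exists l, u; rewrite va'.
    by rewrite (rigid_inj _ _ _ ra rb) bs in as_.
  - by rewrite ss'.
  - move=> c; rewrite inE => /predU1P[->|/s's [b bs rb]].
      by exists a; rewrite ?mem_head //; exists l, u; rewrite va'.
    by exists b; rewrite // inE bs orbT.
case=> [[a as_ [L imL]]|[s' [us' ss' s's]]]; last first.
  exists s'; split=> [//||a' /s's [a as_ [l [u [_ im _]]]]]; first by rewrite ss'.
  by exists a => //; apply: sim_counterpart.
have Lin (i : nat) : (i < k)%N -> valI J Min <= L + i%:Z <= valI J Max.
  by move=> ik; have [|h _] := imL (L + i%:Z); [lia|exact: h].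
pose f (i : 'I_k) : elt (order_of J) := exist _ (L + i%:Z) (Lin i (ltn_ord i)).
exists [seq f i | i <- enum 'I_k]; split.
- rewrite map_inj_uniq ?enum_uniq // => i j /(congr1 val) /= ij.
  by apply: val_inj => /=; lia.
- by rewrite size_map size_enum_ord.
- move=> _ /mapP[i _ ->]; exists a => //; apply: sim_counterpart; apply: imL => /=.
  by have := ltn_ord i; lia.
Qed.

End Anchors.

(** * Successor atoms between variables *)

Definition on_pair (x y : var) (p : var * var) : bool :=
  (p == (x, y)) || (p == (y, x)).

Lemma succ_offset x y p : x != y -> on_pair x y p ->
  exists2 e : int, e = 1 \/ e = -1 &
    forall I (a : elt (order_of I)),
      succI (upd x a) p = (val a == valI I (Var y) + e).
Proof.
move=> xy /orP[/eqP ->|/eqP ->].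
  exists (-1); [by right|move=> I a]; rewrite /succI !valI_upd eqxx.
  have /negPf -> : Var y != Var x by apply: contra xy => /eqP[->].
  by rewrite -subr_eq eq_sym.
exists 1; [by left|move=> I a]; rewrite /succI !valI_upd eqxx.
by have /negPf -> : Var y != Var x by apply: contra xy => /eqP[->].
Qed.

(** The atom only asks whether [x] is the one element [y + e]. If [a] is that element, the same
    neighbour of [y] is its counterpart, because [D'] sees [y] from each anchor one step further
    than [D] sees [x]. If not, a counterpart has one point to avoid, so two candidates are requested
    from [anchors_zone]. *)
Lemma single_succ D D' x y p I J :
    (forall u v, D u v = D v u) -> x != y -> D (Var y) (Var x) = 0%N ->
    on_pair x y p -> eliminates D D' x 1 ->
    (forall u, anchor D x u -> D u (Var x) < D' u (Var y))%N -> sim D' I J ->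
  forall a : elt (order_of I), exists a' : elt (order_of J),
    sim D (upd x a) (upd x a') && (succI (upd x a) p == succI (upd x a') p).
Proof.
move=> Dsym xy Dy0 xyp DD' D'y simIJ a.
have [e e1 succE] := succ_offset xy xyp.
have cl u : anchor D x u ->
    close (D u (Var x)).+1 (valI I (Var y) - valI I u) (valI J (Var y) - valI J u).
  by move=> /D'y le; apply: close_le le (simP _ _ _ simIJ _ _).
have ancMin : anchor D x Min by [].
have ancMax : anchor D x Max by [].
have yI := valI_range I (Var y); have yJ := valI_range J (Var y).
have aI := elt_range a.
have [aE|aN] := eqVneq (val a) (valI I (Var y) + e).
  have [|a' a'E] := @ex_elt J (valI J (Var y) + e).
    by have := cl _ ancMin; have := cl _ ancMax; rewrite /close; lia.
  exists a'; rewrite !succE aE a'E !eqxx andbT.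
  apply: (sim_counterpart Dsym DD' simIJ); split; first by rewrite a'E; have := elt_range a'; lia.
  by move=> u au; have := cl _ au; rewrite /close; lia.
have eq_succ (a' : elt (order_of J)) :
    val a' <> valI J (Var y) + e -> succI (upd x a) p == succI (upd x a') p.
  by move=> /eqP a'N; rewrite !succE (negPf aN) (negPf a'N).
have [[L imL]|[l [u [rl im]]]] := anchors_zone DD' simIJ a (isT : 0 < 2)%N (isT : 2 <= 2)%N.
  pose z := if L == valI J (Var y) + e then L + 1 else L.
  have zL : L <= z < L + 2%:Z by rewrite /z; case: ifP => _; lia.
  have [a' a'E] := ex_elt (imL _ zL).1.
  exists a'; rewrite eq_succ.
    by rewrite andbT; apply: (sim_counterpart Dsym DD' simIJ); rewrite a'E; apply: imL.
  by rewrite a'E /z; case: eqP; lia.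
have [a' a'E] := ex_elt im.1; exists a'; rewrite eq_succ.
  by rewrite andbT; apply: (sim_counterpart Dsym DD' simIJ); rewrite a'E.
(* If the translate hits [y + e] in [J], closeness at [l] and [u] puts [a] on the edge of both
   zones, on the same side of each. The last clause of [rigid_at] then makes one of them an end of
   the order, and [y] would lie beyond it. *)
move: rl => [al au lu [bl bu] [cl1 cu1]]; rewrite a'E => a'y.
have aJ := elt_range a'; rewrite a'E in aJ.
have := cl _ al; have := cl _ au; rewrite /close.
move/eqP: aN => aN.
by case: e1 => e1; case: cl1 => cl1; case: cu1 => cu1; subst; lia.
Qed.

Definition mult (Sig : seq (var * var)) (u v : term) : nat :=
  count (fun p => ((Var p.1 == u) && (Var p.2 == v)) ||
                  ((Var p.1 == v) && (Var p.2 == u))) Sig.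

Lemma mult_sym Sig u v : mult Sig u v = mult Sig v u.
Proof. by apply: eq_count => p /=; rewrite orbC. Qed.

(** 2 is the least threshold that decides whether a difference equals 1. *)
Definition link (D : term -> term -> nat) (Sig : seq (var * var)) u v : nat :=
  maxn (D u v) (2 * (0 < mult Sig u v)).

Lemma link_sym D Sig : (forall u v, D u v = D v u) ->
  forall u v, link D Sig u v = link D Sig v u.
Proof. by move=> Dsym u v; rewrite /link Dsym mult_sym. Qed.

Lemma sim_link D Sig I J : sim (link D Sig) I J -> sim D I J && agree Sig I J.
Proof.
move=> h; rewrite (sim_le _ h) => [/=|u v]; last exact: leq_maxl.
apply/allP=> -[a b] pS; have m : (0 < mult Sig (Var a) (Var b))%N.
  by rewrite -has_count; apply/hasP; exists (a, b) => //=; rewrite !eqxx.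
have /close_le := simP _ _ _ h (Var a) (Var b).
move=> /(_ 2%N); rewrite /link m leq_maxr => /(_ isT) cl.
rewrite /succI /=; apply/eqP; apply/idP/idP => /eqP e; apply/eqP; move: cl; rewrite /close; lia.
Qed.

Lemma at_least_le1 (T U : eqType) (P : T -> Prop) (Q : U -> Prop) k :
  (k <= 1)%N -> (forall a, P a -> exists b, Q b) -> at_least k P -> at_least k Q.
Proof.
case: k => [|[|//]] _ PQ [s [_ ss sP]]; first by exists [::].
case: s ss sP => [|a [|//]] //= _ /(_ a (mem_head _ _)) /PQ[b Qb].
by exists [:: b]; split=> // c; rewrite inE => /eqP ->.
Qed.

(** Two values cannot cover three elements, and in a one-element order the neighbours of the element
    lie outside. *)
Lemma avoid_successors (m M i j e f : int) :
    m <= i <= M -> m <= j <= M -> e = 1 \/ e = -1 -> f = 1 \/ f = -1 ->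
    M <> m + 1 ->
  exists2 c, m <= c <= M & c <> i + e /\ c <> j + f.
Proof.
move=> im jm e1 f1 Mm; have [Mm0|Mm0] := eqVneq M m.
  by exists m; [|split]; lia.
move/eqP: Mm0 => Mm0; move: (i + e) (j + f) => p q.
have [mp|mp] := boolP ((m == p) || (m == q)); last by exists m; lia.
have [Mp|Mp] := boolP ((M == p) || (M == q)); last by exists M; lia.
by exists (m + 1); lia.
Qed.

(* The one case that the accounting for t = 1 does not cover: phi is the
conjunction or disjunction of an atom linking x, y and an atom linking x, z. *)
Section TwoSuccessors.

Variables (x y z : var) (p1 p2 : var * var) (phi : formula) (k : nat).
Variables (D : term -> term -> nat) (I J : interp).
Hypotheses (xy : x != y) (xz : x != z).
Hypotheses (xyp : on_pair x y p1) (xzp : on_pair x z p2).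
Hypothesis k_le1 : (k <= 1)%N.
Hypothesis phi_inv : forall K L, succI K p1 = succI L p1 ->
  succI K p2 = succI L p2 -> satI K phi -> satI L phi.
Hypothesis simIJ : sim D I J.
Hypothesis D_Min : (0 < D Min (Var y))%N /\ (0 < D Min (Var z))%N.
Hypothesis D_Max : (0 < D (Var y) Max)%N /\ (0 < D (Var z) Max)%N.

(** A witness is the neighbour of [y] or of [z] that an atom names. The border entries keep this
    neighbour inside [J]. The two neighbours can coincide only if [y] and [z] are 0 or 2 apart, so
    threshold 3 tells whether they do. *)
Lemma two_successors_exists :
    (forall K, satI K phi -> succI K p1 || succI K p2) ->
    (2 < D (Var y) (Var z))%N ->
  satI I (Exists k x phi) -> satI J (Exists k x phi).
Proof.
move=> phi_succ Dyz; apply: at_least_le1 => // a'; move: (a' : elt (order_of I)) => {a'} a phia.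
have [e e1 succE] := succ_offset xy xyp; have [f f1 succF] := succ_offset xz xzp.
have [Dmy Dmz] := D_Min; have [DMy DMz] := D_Max.
have cmy := close_le Dmy (simP _ _ _ simIJ _ _).
have cmz := close_le Dmz (simP _ _ _ simIJ _ _).
have cMy := close_le DMy (simP _ _ _ simIJ _ _).
have cMz := close_le DMz (simP _ _ _ simIJ _ _).
have cyz := close_le Dyz (simP _ _ _ simIJ _ _).
have aI := elt_range a.
have yI := valI_range I (Var y); have yJ := valI_range J (Var y).
have zI := valI_range I (Var z); have zJ := valI_range J (Var z).
have /orP[] := phi_succ (upd x a) phia.
  rewrite succE => /eqP aE.
  have [|a' a'E] := @ex_elt J (valI J (Var y) + e).
    by move: cmy cMy; rewrite /close; lia.
  exists a'; change (satI (upd x a') phi).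
  apply: (phi_inv _ _ (phia : satI (upd x a) phi)); rewrite ?succE ?succF a'E aE ?eqxx //.
  by clear - cyz e1 f1; move: cyz; rewrite /close; lia.
rewrite succF => /eqP aE.
have [|a' a'E] := @ex_elt J (valI J (Var z) + f).
  by move: cmz cMz; rewrite /close; lia.
exists a'; change (satI (upd x a') phi).
apply: (phi_inv _ _ (phia : satI (upd x a) phi)); rewrite ?succE ?succF a'E aE ?eqxx //.
by clear - cyz e1 f1; move: cyz; rewrite /close; lia.
Qed.

(** An element that satisfies neither atom is a counterexample, and only a two-element order can
    lack one. Threshold 2 at [Min], [Max] makes both orders have two elements in that case; the
    border entries then fix [y] and [z], and the counterexample is copied. *)
Lemma two_successors_forall :
    (forall K, satI K phi -> succI K p1 || succI K p2) -> (1 < D Min Max)%N ->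
  satI I (Forall k x phi) -> satI J (Forall k x phi).
Proof.
move=> phi_succ DmM nI nJ; apply: nI; apply: at_least_le1 nJ => // a'; move: (a' : elt (order_of J)) => {a'} a nphia.
have [e e1 succE] := succ_offset xy xyp; have [f f1 succF] := succ_offset xz xzp.
have [Dmy Dmz] := D_Min; have [DMy DMz] := D_Max.
have cmy := close_le Dmy (simP _ _ _ simIJ _ _).
have cmz := close_le Dmz (simP _ _ _ simIJ _ _).
have cMy := close_le DMy (simP _ _ _ simIJ _ _).
have cMz := close_le DMz (simP _ _ _ simIJ _ _).
have cmM := close_le DmM (simP _ _ _ simIJ _ _).
have aJ := elt_range a.
have yI := valI_range I (Var y); have yJ := valI_range J (Var y).
have zI := valI_range I (Var z); have zJ := valI_range J (Var z).
have far (b : elt (order_of I)) : val b <> valI I (Var y) + e ->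
    val b <> valI I (Var z) + f -> ~ satI (upd x b) phi.
  by move=> /eqP/negPf by_ /eqP/negPf bz /phi_succ; rewrite succE succF by_ bz.
have in_range (c : int) : valI I Min <= c <= valI I Max ->
    (val a - valI J Min = c - valI I Min /\ valI I Max = valI I Min + 1
       /\ valI J Max = valI J Min + 1) \/
    (c <> valI I (Var y) + e /\ c <> valI I (Var z) + f) ->
    exists b : elt (order_of I), ~ satI (upd x b) phi.
  move=> /ex_elt[b bE] [[ac [MI MJ]]|[cy cz]]; exists b; last by apply: far; rewrite bE.
  move=> phib; apply: nphia; change (satI (upd x a) phi).
  apply: (phi_inv _ _ (phib : satI (upd x b) phi)).
    have yy : valI J (Var y) - valI J Min = valI I (Var y) - valI I Min.
      by move: cmy cMy; rewrite /close; lia.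
    by rewrite !succE bE; clear - ac yy; apply/eqP/eqP; lia.
  have zz : valI J (Var z) - valI J Min = valI I (Var z) - valI I Min.
    by move: cmz cMz; rewrite /close; lia.
  by rewrite !succF bE; clear - ac zz; apply/eqP/eqP; lia.
have [M1|M1] := eqVneq (valI I Max) (valI I Min + 1).
  apply: (in_range (val a - valI J Min + valI I Min)).
    by clear - cmM M1 aJ; move: cmM; rewrite /close; lia.
  by left; clear - cmM M1 aJ; move: cmM; rewrite /close; lia.
have [c cI c_far] := avoid_successors yI zI e1 f1 (elimN eqP M1).
by apply: (in_range c cI); right.
Qed.

End TwoSuccessors.

(** * Arithmetic of the size budget *)

Local Open Scope nat_scope.

(** The cross term [2cc'] is at most [2ss'], since [c <= s] and [c' <= s']. *)
Lemma sqr_add_bound c b s c' b' s' :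
  c ^ 2 + b <= s ^ 2 -> c' ^ 2 + b' <= s' ^ 2 ->
  (c + c') ^ 2 + (b + b') <= (s + s') ^ 2.
Proof.
move=> h h'; have cs : c <= s by nia.
have cs' : c' <= s' by nia.
have := leq_mul cs cs'; nia.
Qed.

(** [A], [B], [C] stand for the entries at xy, xz, yz, and are primed once the atoms are folded in.
    If the centre does not grow, the border grows by at most [2s + 1], the gain from [s^2] to
    [(s + 1)^2]. If it grows, some entry was lifted to 2, and the atoms that lifted it add to the
    budget. *)
Lemma plain_step_bound A B C A' B' C' c b s mA mB mC :
  A + B <= c -> A + C <= c -> B + C <= c -> c ^ 2 + b <= s ^ 2 ->
  (mA = 0 \/ 1 < mA \/ 0 < A) -> (mB = 0 \/ 1 < mB \/ 0 < B) ->
  A' = maxn A (2 * (0 < mA)) -> B' = maxn B (2 * (0 < mB)) ->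
  C' = maxn C (2 * (0 < mC)) ->
  (maxn C' (A' + B')) ^ 2 + (b + maxn (0 < s) (2 * maxn A' B'))
    <= (mA + mB + mC + s + 1) ^ 2.
Proof.
move=> AB AC BC cbs hA hB eA eB eC.
have cs : c <= s by nia.
have AE : [\/ A' = A /\ mA = 0, A' = A /\ 1 < A, [/\ A' = 2, A = 1 & 0 < mA]
             | [/\ A' = 2, A = 0 & 1 < mA]].
  have [m0|m0] := posnP mA; rewrite m0 ?muln0 ?muln1 in eA.
    by constructor 1; lia.
  have [A1|A1] := leqP 2 A; first by constructor 2; lia.
  by have [A0|A0] := leqP A 0; [constructor 4|constructor 3]; split; lia.
have BE : [\/ B' = B /\ mB = 0, B' = B /\ 1 < B, [/\ B' = 2, B = 1 & 0 < mB]
             | [/\ B' = 2, B = 0 & 1 < mB]].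
  have [m0|m0] := posnP mB; rewrite m0 ?muln0 ?muln1 in eB.
    by constructor 1; lia.
  have [B1|B1] := leqP 2 B; first by constructor 2; lia.
  by have [B0|B0] := leqP B 0; [constructor 4|constructor 3]; split; lia.
have CE : C' = C \/ [/\ C' = 2, C <= 1 & 0 < mC].
  have [m0|m0] := posnP mC; rewrite m0 ?muln0 ?muln1 in eC; first by left; lia.
  by have [C1|C1] := leqP C 1; [right; split; lia|left; lia].
clear eA eB eC hA hB.
have grow n : n <= mA + mB + mC -> (s + n + 1) ^ 2 <= (mA + mB + mC + s + 1) ^ 2.
  by move=> nm; rewrite leq_sqr; lia.
(* Next to an untouched entry [a], an entry is lifted from 1 to 2 at the price of one atom ([step1])
   or from 0 to 2 at the price of two ([step2]). *)
have step1 a : (a + 1) ^ 2 + b <= s ^ 2 -> (a + 2) ^ 2 + (b + 2 * maxn 2 a) <= (s + 2) ^ 2.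
  move=> h; have sa : a < s by nia.
  by have [a2|a2] := leqP 2 a; nia.
have step2 a : a ^ 2 + b <= s ^ 2 -> (a + 2) ^ 2 + (b + 2 * maxn 2 a) <= (s + 3) ^ 2.
  move=> h; have sa : a <= s by nia.
  by have [a2|a2] := leqP 2 a; nia.
have below a : a <= c -> a ^ 2 + b <= s ^ 2 by move=> ac; nia.
have maxE a : 0 < a -> maxn (0 < s) (2 * a) = 2 * a by case: (0 < s); lia.
have [Kc|Kc] := leqP (maxn C' (A' + B')) c.
  have := grow 0 isT; have : maxn (0 < s) (2 * maxn A' B') <= 2 * s + 1.
    by case: (0 < s); lia.
  by have := below _ Kc; lia.
have [KA|KC] := leqP C' (A' + B').
  rewrite maxE; last lia.
  rewrite (maxn_idPr KA) in Kc *.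
  case: AE => [[e h]|[e h]|[e f h]|[e f h]];
  case: BE => [[e' h']|[e' h']|[e' f' h']|[e' f' h']]; rewrite e e' in Kc *; try lia.
  - by have := step1 _ (below (A + 1) ltac:(lia)); have := grow 1 ltac:(lia); lia.
  - by have := step2 _ (below A ltac:(lia)); have := grow 2 ltac:(lia); lia.
  - by have := step1 _ (below (A + 1) ltac:(lia)); have := grow 1 ltac:(lia); lia.
  - by have := step2 _ (below A ltac:(lia)); have := grow 2 ltac:(lia); lia.
  - by have := step1 _ (below (B + 1) ltac:(lia)); have := grow 1 ltac:(lia); lia.
  - by have := step1 _ (below (B + 1) ltac:(lia)); have := grow 1 ltac:(lia); lia.
  - by have := below 2 ltac:(lia); have := grow 2 ltac:(lia); nia.
  - by have := below 1 ltac:(lia); have := grow 3 ltac:(lia); nia.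
  - by have := step2 _ (below B ltac:(lia)); have := grow 2 ltac:(lia); lia.
  - by have := step2 _ (below B ltac:(lia)); have := grow 2 ltac:(lia); lia.
  - by have := below 1 ltac:(lia); have := grow 3 ltac:(lia); nia.
have [C2 mC1 C1] : [/\ C' = 2, 0 < mC & C <= 1] by case: CE => [|[]]; split; lia.
have [-> ->] : A' = A /\ B' = B by case: AE => [[]|[]|[]|[]]; case: BE => [[]|[]|[]|[]]; split; lia.
have := grow 1 ltac:(lia); rewrite C2.
have [s0|s_gt0] := leqP s 0.
  have s0' : s = 0 by lia.
  subst s; have [c0 b0] : c = 0 /\ b = 0 by split; nia.
  have -> : maxn (0 < 0) (2 * maxn A B) = 0 by lia.
  by lia.
have M2 : maxn (0 < s) (2 * maxn A B) <= 2 by rewrite s_gt0 /=; lia.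
move: (maxn (0 < s) _) M2 => M M2.
by have := below 0 isT; nia.
Qed.

(** The atom between x and y stays out of the table but adds 1 to the budget; [(0 < B')] and the
    final 2 come from [kap = 1]. The excluded case would require [3^2 + 6 <= 3^2]. *)
Lemma single_step_bound B C B' C' c b s mB mC :
  B + C <= c -> c ^ 2 + b <= s ^ 2 -> ~~ [&& s == 0, mB == 1 & mC == 0] ->
  B' = maxn B (2 * (0 < mB)) -> C' = maxn C (2 * (0 < mC)) ->
  (maxn C' (B' + (0 < B'))) ^ 2 + (b + 2 * B' + 2) <= (1 + mB + mC + s + 1) ^ 2.
Proof.
move=> BC cbs nspec eB eC.
have cs : c <= s by nia.
have grow n : n <= mB + mC -> (s + n + 2) ^ 2 <= (1 + mB + mC + s + 1) ^ 2.
  by move=> nm; rewrite leq_sqr; lia.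
have below a : a <= c -> a ^ 2 + b <= s ^ 2 by move=> ac; nia.
have BE : [\/ B' = B /\ mB = 0, B' = B /\ 1 < B | [/\ B' = 2, B <= 1 & 0 < mB]].
  have [m0|m0] := posnP mB; rewrite m0 ?muln0 ?muln1 in eB.
    by constructor 1; lia.
  by have [B1|B1] := leqP 2 B; [constructor 2|constructor 3; split]; lia.
have CE : C' = C \/ [/\ C' = 2, C <= 1 & 0 < mC].
  have [m0|m0] := posnP mC; rewrite m0 ?muln0 ?muln1 in eC; first by left; lia.
  by have [C1|C1] := leqP C 1; [right; split; lia|left; lia].
clear eB eC.
have keep : (B + (0 < B)) ^ 2 + (b + 2 * B + 2) <= (1 + mB + mC + s + 1) ^ 2.
  have Bs : B <= s by lia.
  have B2 : (B + (0 < B)) ^ 2 <= (B + 1) ^ 2 by rewrite leq_sqr; case: (0 < B); lia.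
  have b_s := below B ltac:(lia); have g2 := grow 0 isT.
  apply: leq_trans g2; apply: leq_trans (leq_add B2 (leqnn _)) _.
  by clear - Bs b_s; lia.
have [KB|KC] := leqP C' (B' + (0 < B')).
  case: BE => [[-> _]|[-> _]|[-> B1 mB1]].
  - exact: keep.
  - exact: keep.
  - set g := (1 + mB + mC + s + 1) ^ 2; rewrite /=.
    have b_s := below 0 isT; have [s0|s0] := leqP s 0.
      have g16 : 16 <= g by rewrite -[16]/(4 ^ 2) leq_sqr; lia.
      have b0 : b <= 0 by move: b_s; rewrite (_ : s = 0) //; lia.
      by clear - g16 b0; lia.
    have g3 : (s + 1 + 2) ^ 2 <= g := grow 1 ltac:(lia).
    by clear - g3 b_s s0; lia.
have [C2|[C2 C1 mC1]] := CE; rewrite C2 in KC *; last first.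
  have B1 : B' <= 1 by lia.
  have b_s := below 0 isT; have g3 := grow 1 ltac:(lia).
  by clear - B1 b_s g3; lia.
have B'C : B' < C by case: (B') KC => [|n] /=; lia.
have b_s := below C ltac:(lia); have g2 := grow 0 isT.
have Cs : C <= s by lia.
by apply: leq_trans g2; clear - b_s Cs B'C; lia.
Qed.

(** The left side equals [(c + t)^2 + b - 1], and [c <= t * s]. *)
Lemma thick_step_bound t c b s : 1 < t -> c ^ 2 + b <= (t * s) ^ 2 ->
  (c + t - 1) ^ 2 + (b + 2 * c + 2 * t - 2) <= (t * (s + 1)) ^ 2.
Proof.
move=> t1 h; have cs : c <= t * s by nia.
case: t t1 h cs => // t; rewrite mulnDr muln1; move: (t.+1 * s) => q t1 h cs.
by have := leq_mul (leqnn t) cs; clear - h cs; lia.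
Qed.

(** * Bounds on tables and their behaviour under elimination *)

Lemma other_vars (x : var) : exists y z,
  [/\ x != y, x != z, y != z & forall v, [\/ v = x, v = y | v = z]].
Proof.
by case: x; [exists Y, Z|exists X, Z|exists X, Y]; split=> // -[];
   (by constructor 1) || (by constructor 2) || constructor 3.
Qed.

Lemma VarK u v : (Var u == Var v) = (u == v).
Proof. by apply/eqP/eqP => [[]|->]. Qed.

Definition cost (h d : nat) : nat := if d == 0 then 0 else d + h.

Lemma costP h d : (d = 0 /\ cost h d = 0) \/ (0 < d /\ cost h d = d + h).
Proof. by rewrite /cost; case: posnP => d0; [left|right]. Qed.

Lemma cost_maxn h d e : cost h (maxn d e) <= cost h d + cost h e.
Proof. have := costP h d; have := costP h e; have := costP h (maxn d e); lia. Qed.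

(** Two distinct pairs among three variables share a variable, here [u]. Border entries are measured
    by the induced separator, so an entry 1 is free there. *)
Definition bounded (h : nat) (D : term -> term -> nat) (c b : nat) : Prop :=
  [/\ forall u v w : var, u != v -> u != w -> v != w ->
        cost h (D (Var u) (Var v)) + cost h (D (Var u) (Var w)) <= c,
      (D Min Max).-1 <= b
    & forall u v : var, (D Min (Var u)).-1 + (D (Var v) Max).-1 <= b].

Definition dmax (D E : term -> term -> nat) u v := maxn (D u v) (E u v).

Lemma bounded_dmax h D E c b c' b' :
  bounded h D c b -> bounded h E c' b' -> bounded h (dmax D E) (c + c') (b + b').
Proof.
move=> [Dc Dm Db] [Ec Em Eb]; split=> [u v w uv uw vw||u v]; rewrite /dmax.
- apply: leq_trans (leq_add (Dc _ _ _ uv uw vw) (Ec _ _ _ uv uw vw)).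
  by rewrite addnACA leq_add ?cost_maxn.
- lia.
- have := Db u v; have := Eb u v; lia.
Qed.

(** [P] has to contain the anchors of [x]; it is larger when a further term must be located, as [y]
    is for a lone successor atom. *)
Definition elimD (D : term -> term -> nat) (P : pred term) x kap u v : nat :=
  if (u == Var x) || (v == Var x) then 0
  else if P u && P v then maxn (D u v) (D u (Var x) + D v (Var x) + kap)
  else D u v.

Lemma elimD_sym D P x kap : (forall u v, D u v = D v u) ->
  forall u v, elimD D P x kap u v = elimD D P x kap v u.
Proof.
by move=> Dsym u v; rewrite /elimD orbC andbC (Dsym u v) (addnC (D u _)).
Qed.

Lemma eliminates_elimD D (P : pred term) x kap :
  (forall u, anchor D x u -> P u) -> eliminates D (elimD D P x kap) x kap.
Proof.
move=> aP u v ux vx uv; rewrite /elimD (negPf ux) (negPf vx) /=; split.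
  by case: ifP => // _; rewrite leq_maxl.
by move=> /aP -> /aP ->; rewrite leq_maxr.
Qed.

(** Once [x] is gone, yz is the only pair of variables left, so its cost alone bounds the centre. A
    border entry gains at most [g] through [x], and the border adds up two such entries. *)
Lemma bounded_elimD h D (P : pred term) x y z kap c b g c' b' :
    (forall u v, D u v = D v u) ->
    x != y -> x != z -> y != z -> (forall v, [\/ v = x, v = y | v = z]) ->
    P Min -> P Max -> bounded h D c b ->
    cost h (if P (Var y) && P (Var z)
            then maxn (D (Var y) (Var z)) (D (Var x) (Var y) + D (Var x) (Var z) + kap)
            else D (Var y) (Var z)) <= c' ->
    (D Min (Var x) + D (Var x) Max + kap).-1 <= b' ->
    (P (Var y) -> D (Var x) (Var y) + kap <= g) ->
    (P (Var z) -> D (Var x) (Var z) + kap <= g) -> b + 2 * g <= b' ->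
  bounded h (elimD D P x kap) c' b'.
Proof.
move=> Dsym xy xz yz xyz PMin PMax [_ Dm Db] Nyz mM gy gz bb'; set N := elimD _ _ _ _.
have yx : (Var y == Var x) = false by rewrite VarK eq_sym; apply: negPf.
have zx : (Var z == Var x) = false by rewrite VarK eq_sym; apply: negPf.
have Nx u : N u (Var x) = 0 by rewrite /N /elimD eqxx orbT.
have xN u : N (Var x) u = 0 by rewrite /N /elimD eqxx.
have NyzE : cost h (N (Var y) (Var z)) <= c'.
  by rewrite /N /elimD yx zx /= (Dsym (Var y) (Var x)) (Dsym (Var z) (Var x)).
have NzyE : cost h (N (Var z) (Var y)) <= c' by rewrite /N elimD_sym.
have NMin (v : var) : (N Min (Var v)).-1 <= maxn (D Min (Var v)).-1 ((D Min (Var x)).-1 + g).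
  case: (xyz v) => ->; first by rewrite Nx.
    rewrite /N /elimD yx PMin /= (Dsym (Var y)); case: ifP => [/gy|_]; clear; lia.
  rewrite /N /elimD zx PMin /= (Dsym (Var z)); case: ifP => [/gz|_]; clear; lia.
have NMax (v : var) : (N (Var v) Max).-1 <= maxn (D (Var v) Max).-1 ((D (Var x) Max).-1 + g).
  case: (xyz v) => ->; first by rewrite xN.
    rewrite /N /elimD yx PMax andbT /= (Dsym (Var y) (Var x)) (Dsym Max (Var x)).
    by case: ifP => [/gy|_]; clear; lia.
  rewrite /N /elimD zx PMax andbT /= (Dsym (Var z) (Var x)) (Dsym Max (Var x)).
  by case: ifP => [/gz|_]; clear; lia.
split=> [u v w||u v].
- by case: (xyz u) => ->; case: (xyz v) => ->; case: (xyz w) => ->;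
     rewrite ?eqxx // ?xN ?Nx ?addn0.
- by rewrite /N /elimD PMin PMax /= (Dsym Max (Var x)); lia.
- have := Db u v; have := Db u x; have := Db x v; have := Db x x.
  have := NMin u; have := NMax v; move: bb'; clear; lia.
Qed.

Lemma anchorV D x y : (forall u v, D u v = D v u) -> x != y ->
  anchor D x (Var y) = (0 < D (Var x) (Var y)).
Proof. by move=> Dsym xy; rewrite /anchor VarK eq_sym xy Dsym. Qed.

(** The surcharges balance: for [kap = 2t - 3] one has [kap + (t - 2) = 2(t - 2) + (t - 1)], so the
    new entry at yz costs at most [t - 1] more than the two entries it replaces. *)
Lemma bounded_elim_thick t D x c b : 1 < t -> (forall u v, D u v = D v u) ->
  bounded (t - 2) D c b ->
  bounded (t - 2) (elimD D (anchor D x) x (2 * t - 3)) (c + t - 1)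
    (b + 2 * c + 2 * t - 2).
Proof.
move=> t1 Dsym Dcb; have [y [z [xy xz yz xyz]]] := other_vars x.
have [Dc Dm Db] := Dcb.
have c1 := Dc _ _ _ xy xz yz.
have c2 : cost (t - 2) (D (Var y) (Var z)) <= c.
  by apply: leq_trans (Dc y z x _ _ _); rewrite ?leq_addr // eq_sym.
have b1 := Db x x; clear Dc Db.
have k1 := costP (t - 2) (D (Var x) (Var y)).
have k2 := costP (t - 2) (D (Var x) (Var z)).
apply: (bounded_elimD (y := y) (z := z) (g := c + t - 1) Dsym _ _ _ _ _ _ Dcb) => //.
- rewrite !anchorV //; case: ifP => [/andP[Dy Dz]|_]; last lia.
  have := costP (t - 2) (D (Var y) (Var z)).
  have := costP (t - 2) (maxn (D (Var y) (Var z))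
    (D (Var x) (Var y) + D (Var x) (Var z) + (2 * t - 3))).
  lia.
- lia.
- by rewrite anchorV // => Dy; lia.
- by rewrite anchorV // => Dy; lia.
- lia.
Qed.

(** * Atoms, connectives and quantifiers on tables *)

Definition pt (p q : term) (d : nat) (u v : term) : nat :=
  if ((u == p) && (v == q)) || ((u == q) && (v == p)) then d else 0.

Lemma pt_sym p q d u v : pt p q d u v = pt p q d v u.
Proof. by rewrite /pt orbC !(andbC (v == _)). Qed.

Lemma sim_pt p q d I J : sim (pt p q d) I J ->
  close d (valI I q - valI I p)%R (valI J q - valI J p)%R.
Proof. by move/simP/(_ p q); rewrite /pt !eqxx. Qed.

Definition varpair (p q : term) : bool :=
  if (p, q) is (Var _, Var _) then true else false.

Lemma bounded_pt h p q d :
  bounded h (pt p q d) (if varpair p q then cost h d else 0)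
                       (if varpair p q then 0 else d.-1).
Proof.
by split=> [[] [] [] //||[] []]; case: p => [||[]]; case: q => [||[]];
  rewrite /pt /= ?addn0 ?add0n ?leqnn.
Qed.

Lemma sim_dmax D E I J : sim (dmax D E) I J -> sim D I J && sim E I J.
Proof.
by move=> h; apply/andP; split; apply: sim_le h => u v;
  rewrite /dmax (leq_maxl, leq_maxr).
Qed.

Lemma preserved_neg D Sig f : preserved D Sig f -> preserved D Sig (Neg f).
Proof.
move=> inv I J; rewrite sim_sym agree_sym => s a nf fJ; exact: nf (inv _ _ s a fJ).
Qed.

Lemma preserved_or D E Sig1 Sig2 f g : preserved D Sig1 f -> preserved E Sig2 g ->
  preserved (dmax D E) (Sig1 ++ Sig2) (Or f g).
Proof.
move=> invf invg I J /sim_dmax/andP[sD sE]; rewrite agree_cat => /andP[a1 a2].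
by case=> [/(invf _ _ sD a1)|/(invg _ _ sE a2)]; [left|right].
Qed.

Lemma preserved_and D E Sig1 Sig2 f g : preserved D Sig1 f -> preserved E Sig2 g ->
  preserved (dmax D E) (Sig1 ++ Sig2) (And f g).
Proof.
move=> invf invg I J /sim_dmax/andP[sD sE]; rewrite agree_cat => /andP[a1 a2].
by case=> /(invf _ _ sD a1) fJ /(invg _ _ sE a2) gJ; split.
Qed.

Lemma dmax_sym D E : (forall u v, D u v = D v u) -> (forall u v, E u v = E v u) ->
  forall u v, dmax D E u v = dmax D E v u.
Proof. by move=> Ds Es u v; rewrite /dmax Ds Es. Qed.

Lemma preserved_equal p q : preserved (pt p q 1) [::] (Equal p q).
Proof.
move=> I J /sim_pt cl _ pq; apply: val_inj.
have {}pq : valI I p = valI I q by rewrite /valI (pq : eval _ p = eval _ q).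
have : valI J p = valI J q by move: cl; rewrite pq /close; lia.
by [].
Qed.

Lemma preserved_less p q : preserved (pt p q 1) [::] (Less p q).
Proof.
move=> I J /sim_pt cl _ pq; change (valI J p < valI J q)%R.
by have : (valI I p < valI I q)%R := pq; move: cl; rewrite /close; lia.
Qed.

Lemma preserved_succ p q : preserved (pt p q 2) [::] (Succ p q).
Proof.
move=> I J /sim_pt cl _ pq; change (valI J q = valI J p + 1)%R.
by have : (valI I q = valI I p + 1)%R := pq; move: cl; rewrite /close; lia.
Qed.

Definition quantified (k : nat) (x : var) (phi chi : formula) : Prop :=
  chi = Exists k x phi \/ chi = Forall k x phi.

Lemma preserved_quantified D D' Sig k x phi chi : quantified k x phi chi ->
    preserved D Sig phi ->
    (forall I J, sim D' I J ->
       matching k x (fun K L => sim D K L && agree Sig K L) I J) ->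
  preserved D' [::] chi.
Proof.
move=> chiE inv m I J s _; case: chiE => ->.
  apply: matching_exists (m I J s) => K L /andP[]; exact: inv.
apply: matching_forall (m J I _); last by rewrite sim_sym.
by move=> K L; rewrite sim_sym agree_sym => /andP[]; exact: inv.
Qed.

Lemma matching_impl k x (E F : interp -> interp -> Prop) I J :
  (forall K L, E K L -> F K L) -> matching k x E I J -> matching k x F I J.
Proof.
move=> EF m s us ss; have [s' [us' ss' s's]] := m s us ss.
by exists s'; split=> // a' /s's [a as_ /EF]; exists a.
Qed.

(** * Induction for t at least 2 *)

Definition thick_inv (t : nat) (phi : formula) : Prop := exists D c b,
  [/\ forall u v, D u v = D v u, preserved D [::] phi, bounded (t - 2) D c b
    & c ^ 2 + b <= (t * fsize phi) ^ 2].

Lemma thick_atom t p q d phi : 1 < t -> fsize phi = 1 -> 0 < d <= 2 ->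
  preserved (pt p q d) [::] phi -> thick_inv t phi.
Proof.
move=> t1 f1 d2 inv; exists (pt p q d).
exists (if varpair p q then cost (t - 2) d else 0), (if varpair p q then 0 else d.-1).
split=> //; [exact: pt_sym|exact: bounded_pt|].
rewrite f1 muln1; case: ifP => _; last by nia.
(* The cost is at most [d + t - 2 <= t], with equality for a successor atom. *)
have := costP (t - 2) d => h; rewrite addn0 leq_sqr; lia.
Qed.

Lemma thick_invP t phi : 1 < t -> in_C3 t phi -> thick_inv t phi.
Proof.
move=> t1; elim: phi => [p q|p q|p q|f IHf|f IHf g IHg|f IHf g IHg|k x f IHf|k x f IHf] /=.
- by move=> _; apply: (@thick_atom _ p q 1) => //; apply: preserved_equal.
- by move=> _; apply: (@thick_atom _ p q 1) => //; apply: preserved_less.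
- by move=> _; apply: (@thick_atom _ p q 2) => //; apply: preserved_succ.
- move=> /IHf[D [c [b [Ds inv bd le]]]]; exists D, c, b; split=> //.
    exact: preserved_neg.
  by apply: leq_trans le _; rewrite leq_sqr leq_mul2l leqnSn orbT.
- move=> /andP[/IHf[D [c [b [Ds inv bd le]]]] /IHg[D' [c' [b' [Ds' inv' bd' le']]]]].
  exists (dmax D D'), (c + c'), (b + b'); split.
  + exact: dmax_sym.
  + exact: (preserved_or inv inv').
  + exact: bounded_dmax.
  + by rewrite /= mulnDr; apply: sqr_add_bound.
- move=> /andP[/IHf[D [c [b [Ds inv bd le]]]] /IHg[D' [c' [b' [Ds' inv' bd' le']]]]].
  exists (dmax D D'), (c + c'), (b + b'); split.
  + exact: dmax_sym.
  + exact: (preserved_and inv inv').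
  + exact: bounded_dmax.
  + by rewrite /= mulnDr; apply: sqr_add_bound.
all: move=> /andP[kt /IHf[D [c [b [Ds inv bd le]]]]].
all: exists (elimD D (anchor D x) x (2 * t - 3)), (c + t - 1), (b + 2 * c + 2 * t - 2).
all: split; [exact: elimD_sym| |exact: bounded_elim_thick|by have := thick_step_bound t1 le; rewrite addn1].
all: apply: (preserved_quantified (k := k) (x := x) (phi := f) _ inv); [by [left|right]|move=> I J s].
(* For [k <= t], the value [kap = 2t - 3] is just large enough for [2 * k <= kap + 3]. *)
all: apply: matching_impl (matching_eliminates Ds (eliminates_elimD _ (P := anchor D x) (x := x) _) s _ _) => [K L ->|//||]; rewrite //; lia.
Qed.

(** * Quantifiers and induction for t = 1 *)

Lemma multE Sig x y : mult Sig (Var x) (Var y) = count (on_pair x y) Sig.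
Proof.
apply: eq_count => -[u v] /=; rewrite /on_pair !VarK !xpair_eqE.
by congr orb; rewrite andbC.
Qed.

Lemma mult_border Sig u v : (u \in [:: Min; Max]) || (v \in [:: Min; Max]) ->
  mult Sig u v = 0.
Proof.
move=> uv; rewrite /mult (eq_count (a2 := pred0)) ?count_pred0 // => p /=.
apply/negP=> /orP[] /andP[/eqP pu /eqP pv]; move: uv; rewrite -pu -pv !inE //.
Qed.

Definition irreflexive_pairs (Sig : seq (var * var)) : bool :=
  all (fun p => p.1 != p.2) Sig.

Lemma size_mult Sig x y z : x != y -> x != z -> y != z ->
    (forall v, [\/ v = x, v = y | v = z]) -> irreflexive_pairs Sig ->
  size Sig = mult Sig (Var x) (Var y) + mult Sig (Var x) (Var z)
             + mult Sig (Var y) (Var z).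
Proof.
move=> xy xz yz xyz; rewrite !multE; elim: Sig => //= -[u v] Sig IH /andP[/= uv /IH ->].
have E : on_pair x y (u, v) + on_pair x z (u, v) + on_pair y z (u, v) = 1.
  rewrite /on_pair !xpair_eqE; have := xyz u; have := xyz v.
  have yx : y != x by rewrite eq_sym.
  have zx : z != x by rewrite eq_sym.
  have zy : z != y by rewrite eq_sym.
  by move=> [] ev [] eu; subst u v; rewrite ?eqxx in uv *;
    rewrite ?(negPf xy) ?(negPf xz) ?(negPf yz) ?(negPf yx) ?(negPf zx) ?(negPf zy).
lia.
Qed.

(** A crude bound on the centre suffices, because [bounded_elimD] recomputes the centre from the
    surviving pair. *)
Lemma bounded_link D Sig c b : bounded 0 D c b -> bounded 0 (link D Sig) (c + 4) b.
Proof.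
move=> [Dc Dm Db]; split=> [u v w uv uw vw||u v]; rewrite /link.
- have := Dc _ _ _ uv uw vw.
  have := cost_maxn 0 (D (Var u) (Var v)) (2 * (0 < mult Sig (Var u) (Var v))).
  have := cost_maxn 0 (D (Var u) (Var w)) (2 * (0 < mult Sig (Var u) (Var w))).
  have : forall e : bool, cost 0 (2 * e) <= 2 by case.
  move=> h; have := h (0 < mult Sig (Var u) (Var v)).
  have := h (0 < mult Sig (Var u) (Var w)); lia.
- by rewrite mult_border // maxn0.
- by rewrite !mult_border ?orbT // !maxn0.
Qed.

Lemma link_border D Sig u v : (u \in [:: Min; Max]) || (v \in [:: Min; Max]) ->
  link D Sig u v = D u v.
Proof. by move=> uv; rewrite /link mult_border // maxn0. Qed.

Lemma cost0 d : cost 0 d = d.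
Proof. by rewrite /cost addn0; case: eqP. Qed.

Definition good_elim (chi : formula) (n : nat) : Prop := exists D c b,
  [/\ forall u v, D u v = D v u, preserved D [::] chi, bounded 0 D c b
    & c ^ 2 + b <= n ^ 2].

Section ThinQuantifier.

Variables (k : nat) (x y z : var) (phi chi : formula).
Hypothesis k_le1 : k <= 1.
Hypothesis chiE : quantified k x phi chi.
Hypotheses (xy : x != y) (xz : x != z) (yz : y != z).
Hypothesis xyz : forall v, [\/ v = x, v = y | v = z].

Variables (Sig : seq (var * var)) (D : term -> term -> nat) (S c b : nat).
Hypothesis Dsym : forall u v, D u v = D v u.
Hypothesis irr : irreflexive_pairs Sig.
Hypothesis inv : preserved D Sig phi.
Hypothesis bd : bounded 0 D c b.
Hypothesis cbS : c ^ 2 + b <= S ^ 2.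

Local Notation mu u v := (mult Sig (Var u) (Var v)).

Lemma thin_quantifier_plain :
    (S = 0 -> forall u v, D u v = 0) ->
    mu x y = 0 \/ 1 < mu x y \/ 0 < D (Var x) (Var y) ->
    mu x z = 0 \/ 1 < mu x z \/ 0 < D (Var x) (Var z) ->
  good_elim chi (size Sig + S + 1).
Proof.
move=> D0 hy hz; have [Dc Dm Db] := bd.
have D1sym := link_sym Sig Dsym.
set D1 := link D Sig in D1sym.
pose A := D1 (Var x) (Var y); pose B := D1 (Var x) (Var z).
pose C := D1 (Var y) (Var z).
(* The new entry at [Min], [Max] adds two thresholds before subtracting 1, so it may exceed the old
   border by 1. This is the term [(0 < S)]; if [S = 0], the table vanishes. *)
exists (elimD D1 (anchor D1 x) x 0), (maxn C (A + B)), (b + maxn (0 < S) (2 * maxn A B)).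
split; first exact: elimD_sym.
- apply: (preserved_quantified chiE inv) => I J s.
  have el : eliminates D1 (elimD D1 (anchor D1 x) x 0) x 0 by apply: eliminates_elimD.
  apply: matching_impl (matching_eliminates D1sym el s _ _) => //; last lia.
  by move=> K L; apply: sim_link.
- apply: (bounded_elimD (y := y) (z := z) (g := maxn A B) D1sym _ _ _ _ _ _ (bounded_link Sig bd)) => //.
  + by rewrite !anchorV // cost0 addn0 -/A -/B -/C; case: ifP => _; rewrite ?leq_maxl.
  + rewrite /D1 !link_border ?orbT // addn0; have [s0|s0] := leqP S 0.
      by rewrite !D0 //; lia.
    by have := Db x x; clear - s0; lia.
  + by rewrite addn0 leq_maxl.
  + by rewrite addn0 leq_maxr.
  + by rewrite leq_add2l leq_maxr.
rewrite (size_mult xy xz yz xyz irr).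
have c1 := Dc _ _ _ xy xz yz.
have c2 := Dc y x z; have c3 := Dc z x y; rewrite !cost0 in c1 c2 c3.
apply: (plain_step_bound (A := D (Var x) (Var y)) (B := D (Var x) (Var z))
  (C := D (Var y) (Var z)) (c := c)) => //.
- by rewrite (Dsym (Var x)); apply: c2; rewrite // eq_sym.
- by rewrite addnC (Dsym (Var x)) (Dsym (Var y)) addnC; apply: c3; rewrite // eq_sym.
Qed.

(** The only atom between x and y is removed from [Sig] and left to [single_succ], while the other
    atoms are folded into the table. Adding y to [P] records its position relative to the anchors,
    as that lemma demands. *)
Lemma thin_quantifier_single :
    mu x y = 1 -> D (Var x) (Var y) = 0 ->
    ~~ [&& S == 0, mu x z == 1 & mu y z == 0] ->
  good_elim chi (size Sig + S + 1).
Proof.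
move=> mxy Dxy nspec; have [Dc Dm Db] := bd.
have /hasP[p pS xyp] : has (on_pair x y) Sig by rewrite has_count -multE mxy.
pose Sig' := rem p Sig; have pSig := perm_to_rem pS.
have mult_rem u v : mu u v = on_pair u v p + mult Sig' (Var u) (Var v).
  by rewrite !multE (permP pSig) /=.
have yx : y != x by rewrite eq_sym.
have zx : z != x by rewrite eq_sym.
have zy : z != y by rewrite eq_sym.
have nxz : on_pair x z p = false.
  by case/orP: xyp => /eqP ->; rewrite /on_pair !xpair_eqE
    ?(negPf xy) ?(negPf xz) ?(negPf yz) ?(negPf yx) ?(negPf zx) ?(negPf zy) ?andbF.
have nyz : on_pair y z p = false.
  by case/orP: xyp => /eqP ->; rewrite /on_pair !xpair_eqE
    ?(negPf xy) ?(negPf xz) ?(negPf yz) ?(negPf yx) ?(negPf zx) ?(negPf zy) ?andbF.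
have mxy' : mult Sig' (Var x) (Var y) = 0 by move: mxy; rewrite mult_rem xyp add1n => -[].
have mxz' : mult Sig' (Var x) (Var z) = mu x z by rewrite mult_rem nxz.
have myz' : mult Sig' (Var y) (Var z) = mu y z by rewrite mult_rem nyz.
have D1sym := link_sym Sig' Dsym.
set D1 := link D Sig' in D1sym.
have D1xy : D1 (Var x) (Var y) = 0 by rewrite /D1 /link Dxy mxy'.
pose B := D1 (Var x) (Var z); pose C := D1 (Var y) (Var z).
pose P := [pred u | anchor D1 x u || (u == Var y)].
exists (elimD D1 P x 1), (maxn C (B + (0 < B))), (b + 2 * B + 2).
have elimP : eliminates D1 (elimD D1 P x 1) x 1.
  by apply: eliminates_elimD => u au; rewrite /= au.
have Pz : P (Var z) = (0 < B) by rewrite /= anchorV // VarK (negPf zy) orbF.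
have Py : P (Var y) by rewrite /= eqxx orbT.
split; first exact: elimD_sym.
- apply: (preserved_quantified chiE inv) => I J s.
  apply: matching_point => // a.
  have D1yx : D1 (Var y) (Var x) = 0 by rewrite D1sym.
  have [|a' /andP[sim_a succ_a]] := single_succ D1sym xy D1yx xyp elimP _ s a.
    move=> u au; have /andP[ux _] := au.
    have Pu : P u by rewrite /= au.
    by rewrite /elimD (negPf ux) VarK (negPf yx) Pu Py D1yx addn0 addn1 leq_max leqnn orbT.
  exists a'; have /andP[-> aS] := sim_link sim_a.
  by rewrite /agree (perm_all _ pSig) /= succ_a.
- apply: (bounded_elimD (y := y) (z := z) (g := B + 1) D1sym _ _ _ _ _ _ (bounded_link Sig' bd)) => //.
  + by rewrite Pz Py cost0 D1xy -/B -/C; clear; move: B C => B C; case: (posnP B) => B0 /=; lia.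
  + rewrite /D1 !link_border ?orbT //; have := Db x x; clear; lia.
  + by rewrite D1xy add0n addn1.
  + by rewrite -/B; clear; lia.
rewrite (size_mult xy xz yz xyz irr) mxy.
have c2 := Dc z x y; rewrite !cost0 in c2.
apply: (single_step_bound (B := D (Var x) (Var z)) (C := D (Var y) (Var z)) (c := c)) => //.
- by rewrite (Dsym (Var x)) (Dsym (Var y)); apply: c2; rewrite // eq_sym.
- by rewrite /B /D1 /link mxz'.
- by rewrite /C /D1 /link myz'.
Qed.

Lemma thin_quantifier_two :
    (forall u v, D u v = 0) -> (forall K, satI K phi -> has (succI K) Sig) ->
    mu x y = 1 -> mu x z = 1 -> mu y z = 0 ->
  good_elim chi 3.
Proof.
move=> D0 phi_succ mxy mxz myz.
have /hasP[p pS xyp] : has (on_pair x y) Sig by rewrite has_count -multE mxy.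
have /hasP[q qS xzq] : has (on_pair x z) Sig by rewrite has_count -multE mxz.
have sizeS := size_mult xy xz yz xyz irr; rewrite mxy mxz myz in sizeS.
have pq : p != q.
  have yx : y != x by rewrite eq_sym.
  by apply/eqP=> pq; move: xyp xzq; rewrite pq => /orP[] /eqP ->;
    rewrite /on_pair !xpair_eqE ?(negPf yz) ?(negPf xz) ?(negPf xy) ?(negPf yx) ?andbF.
have Spq r : r \in Sig -> r = p \/ r = q.
  case: Sig sizeS pS qS => [|s1 [|s2 [|//]]] //= _; rewrite !inE.
  move=> /orP[] /eqP ep /orP[] /eqP eq /orP[] /eqP er; subst; auto;
  by rewrite eqxx in pq.
have inv' K L : succI K p = succI L p -> succI K q = succI L q -> satI K phi -> satI L phi.
  move=> ep eq; apply: inv; first by apply/simP=> u v; rewrite D0 /close.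
  by apply/allP=> r /Spq[] ->; apply/eqP.
have phi_succ' K : satI K phi -> succI K p || succI K q.
  by move=> /phi_succ /hasP[r /Spq[] -> ->]; rewrite ?orbT.
(* Border entries 1 are free. The tables [E 3 0] for [Exists] and [E 0 2] for [Forall] weigh [3^2]
   and [1], both within [3^2]. *)
pose bo (u v : term) : nat := (u \in [:: Min; Max]) || (v \in [:: Min; Max]).
pose E d e := dmax (pt (Var y) (Var z) d) (dmax (pt Min Max e) bo).
have bo_sym u v : bo u v = bo v u by rewrite /bo orbC.
have Esym d e u v : E d e u v = E d e v u.
  by apply: dmax_sym => {u v}; [exact: pt_sym|apply: dmax_sym => //; exact: pt_sym].
have bd_bo : bounded 0 bo 0 0 by split.
have bdE d e : bounded 0 (E d e) (d + (0 + 0)) (0 + (e.-1 + 0)).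
  apply: bounded_dmax; first by have := bounded_pt 0 (Var y) (Var z) d; rewrite /= cost0.
  by apply: bounded_dmax => //; have := bounded_pt 0 Min Max e.
have E_Min d e v : 0 < E d e Min (Var v).
  by rewrite /E /dmax !leq_max /bo !orbT.
have E_Max d e v : 0 < E d e (Var v) Max.
  by rewrite /E /dmax !leq_max /bo !orbT.
case: chiE => ->.
  exists (E 3 0), 3, 0; split; [exact: Esym| |exact: (bdE 3 0)|by []].
  move=> I J s _; apply: (two_successors_exists xy xz xyp xzq k_le1 inv' s) => //.
  by rewrite /E /dmax leq_max /pt !eqxx.
exists (E 0 2), 0, 1; split; [exact: Esym| |exact: (bdE 0 2)|by []].
move=> I J s _; apply: (two_successors_forall xy xz xyp xzq k_le1 inv' s) => //.
Qed.

End ThinQuantifier.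

(* The atoms in Sig pay for themselves; S is the size left to pay for c and b. *)
Definition thin_inv (phi : formula) : Prop := exists Sig D S c b,
  [/\ fsize phi = size Sig + S, forall u v, D u v = D v u,
      irreflexive_pairs Sig & preserved D Sig phi] /\
  [/\ bounded 0 D c b, c ^ 2 + b <= S ^ 2, S = 0 -> forall u v, D u v = 0
    & S = 0 -> forall K, satI K phi -> has (succI K) Sig].

(** A lone atom that the table does not cover may link x to either remaining variable, and the two
    cases are exchanged by swapping them. Without such an atom everything is folded into the
    table. *)
Lemma thin_quantifier k x phi chi : k <= 1 -> quantified k x phi chi ->
  thin_inv phi -> good_elim chi (fsize phi + 1).
Proof.
move=> k1 chiE [Sig [D [S [c [b [[sz Ds irr inv] [bd le D0 has0]]]]]]].
have [y [z [xy xz yz xyz]]] := other_vars x.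
have zy : z != y by rewrite eq_sym.
have xzy v : [\/ v = x, v = z | v = y].
  by case: (xyz v); [constructor 1|constructor 3|constructor 2].
have two : S = 0 -> mult Sig (Var x) (Var y) = 1 -> mult Sig (Var x) (Var z) = 1 ->
    mult Sig (Var y) (Var z) = 0 -> good_elim chi (fsize phi + 1).
  move=> S0 my mz myz; rewrite sz S0 (size_mult xy xz yz xyz irr) my mz myz.
  exact: (thin_quantifier_two k1 chiE xy xz yz xyz irr inv (D0 S0) (has0 S0)).
have [/andP[/eqP my /eqP Dy]|ny] :=
  boolP ((mult Sig (Var x) (Var y) == 1) && (D (Var x) (Var y) == 0)).
  have [/and3P[/eqP S0 /eqP mz /eqP myz]|nspec] :=
    boolP [&& S == 0, mult Sig (Var x) (Var z) == 1 & mult Sig (Var y) (Var z) == 0].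
    exact: two.
  by rewrite sz; apply: (thin_quantifier_single k1 chiE xy xz yz xyz Ds irr inv bd le).
have [/andP[/eqP mz /eqP Dz]|nz] :=
  boolP ((mult Sig (Var x) (Var z) == 1) && (D (Var x) (Var z) == 0)).
  have [/and3P[/eqP S0 /eqP my /eqP mzy]|nspec] :=
    boolP [&& S == 0, mult Sig (Var x) (Var y) == 1 & mult Sig (Var z) (Var y) == 0].
    by apply: two => //; rewrite mult_sym.
  by rewrite sz; apply: (thin_quantifier_single k1 chiE xz xy zy xzy Ds irr inv bd le).
rewrite sz; apply: (thin_quantifier_plain k1 chiE xy xz yz xyz Ds irr inv bd le D0).
  by clear - ny; lia.
by clear - nz; lia.
Qed.

Lemma thin_atom p q d phi : fsize phi = 1 -> d <= 2 -> (d <= 1) || ~~ varpair p q ->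
  preserved (pt p q d) [::] phi -> thin_inv phi.
Proof.
move=> f1 d2 hd inv; exists [::], (pt p q d), 1.
exists (if varpair p q then cost 0 d else 0), (if varpair p q then 0 else d.-1).
split; split=> //; first exact: pt_sym.
  exact: bounded_pt.
by rewrite cost0; case: (varpair p q) hd; case: d {inv} d2 => [|[|[|]]].
Qed.

Lemma thin_succ u v : u != v -> thin_inv (Succ (Var u) (Var v)).
Proof.
move=> uv; exists [:: (u, v)], (fun _ _ => 0), 0, 0, 0.
split; split=> //; first by rewrite /irreflexive_pairs /= uv.
  move=> I J _ /=; rewrite /agree /= andbT => /eqP e.
  move=> h; have : succI I (u, v) by apply/eqP.
  by rewrite e => /eqP.
by move=> _ K h /=; rewrite orbF; apply/eqP.
Qed.

(** This atom is false everywhere, so the zero table serves; it stays out of [Sig], which admits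
    irreflexive pairs only. *)
Lemma thin_succ_refl u : thin_inv (Succ (Var u) (Var u)).
Proof.
exists [::], (fun _ _ => 0), 1, 0, 0; split; split=> //.
move=> I J _ _ h; have : (valI I (Var u) = valI I (Var u) + 1)%R by exact: h.
by move: (valI I (Var u)) => a; lia.
Qed.

Lemma thin_good phi : good_elim phi (fsize phi) -> 0 < fsize phi -> thin_inv phi.
Proof.
move=> [D [c [b [Ds inv bd le]]]] f0; exists [::], D, (fsize phi), c, b.
by split; split=> // e; rewrite e in f0.
Qed.

Lemma thin_invP phi : in_C3 1 phi -> thin_inv phi.
Proof.
elim: phi => [p q|p q|p q|f IHf|f IHf g IHg|f IHf g IHg|k x f IHf|k x f IHf] /=.
- by move=> _; apply: (@thin_atom p q 1) => //; apply: preserved_equal.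
- by move=> _; apply: (@thin_atom p q 1) => //; apply: preserved_less.
- move=> _; have [|npq] := boolP (varpair p q); last first.
    by apply: (@thin_atom p q 2) => //; apply: preserved_succ.
  case: p q => [||u] [||v] // _; have [->|uv] := eqVneq u v.
    exact: thin_succ_refl.
  exact: thin_succ.
- move=> /IHf[Sig [D [S [c [b [[sz Ds irr inv] [bd le D0 has0]]]]]]].
  (* A negation is booked in [S], so [S = 0] leaves positive combinations of successor atoms, whose
     models satisfy one of the atoms. *)
  exists Sig, D, S.+1, c, b; split; split=> //; first by rewrite /= sz addnS.
    exact: preserved_neg.
  by apply: leq_trans le _; rewrite leq_sqr.
- move=> /andP[/IHf[Sig [D [S [c [b [[sz Ds irr inv] [bd le D0 has0]]]]]]]].
  move=> /IHg[Sig' [D' [S' [c' [b' [[sz' Ds' irr' inv'] [bd' le' D0' has0']]]]]]].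
  exists (Sig ++ Sig'), (dmax D D'), (S + S'), (c + c'), (b + b').
  split; split.
  + by rewrite /= sz sz' size_cat addnACA.
  + exact: dmax_sym.
  + by rewrite /irreflexive_pairs all_cat; apply/andP.
  + exact: preserved_or.
  + exact: bounded_dmax.
  + exact: sqr_add_bound.
  + by move=> /eqP; rewrite addn_eq0 => /andP[/eqP/D0 e /eqP/D0' e'] u v; rewrite /dmax e e'.
  + move=> /eqP; rewrite addn_eq0 => /andP[/eqP/has0 h /eqP/has0' h'] K.
    by rewrite has_cat => -[/h ->|/h' ->] //; rewrite orbT.
- move=> /andP[/IHf[Sig [D [S [c [b [[sz Ds irr inv] [bd le D0 has0]]]]]]]].
  move=> /IHg[Sig' [D' [S' [c' [b' [[sz' Ds' irr' inv'] [bd' le' D0' has0']]]]]]].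
  exists (Sig ++ Sig'), (dmax D D'), (S + S'), (c + c'), (b + b').
  split; split.
  + by rewrite /= sz sz' size_cat addnACA.
  + exact: dmax_sym.
  + by rewrite /irreflexive_pairs all_cat; apply/andP.
  + exact: preserved_and.
  + exact: bounded_dmax.
  + exact: sqr_add_bound.
  + by move=> /eqP; rewrite addn_eq0 => /andP[/eqP/D0 e /eqP/D0' e'] u v; rewrite /dmax e e'.
  + move=> /eqP; rewrite addn_eq0 => /andP[/eqP/has0 h _] K.
    by rewrite has_cat => -[/h ->].
all: move=> /andP[k1 /IHf tf]; apply: thin_good => //=; rewrite -addn1.
all: apply: (thin_quantifier k1 _ tf); by [left|right].
Qed.

(** * From tables to separators *)

Lemma distinct_vars (u v w : var) : u != v -> u != w -> v != w ->
  forall a, [\/ a = u, a = v | a = w].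
Proof.
by case: u v w => [] [] [] // _ _ _ [];
   (by constructor 1) || (by constructor 2) || constructor 3.
Qed.

(** An unordered pair does not say which element comes first, so the maximum runs over both
    enumerations; for a symmetric [D] they agree. *)
Definition separator_of (D : term -> term -> nat) : separator :=
  fun p => \max_u \max_(v | val p == [set u; v]) (D u v).-1.

Lemma separator_ofE D p u v : (forall u v, D u v = D v u) ->
  val p = [set u; v] -> separator_of D p = (D u v).-1.
Proof.
move=> Ds pE; apply/eqP; rewrite eqn_leq; apply/andP; split.
  apply/bigmax_leqP=> u' _; apply/bigmax_leqP=> v' /eqP; rewrite pE => e.
  have := set21 u' v'; have := set22 u' v'; rewrite -e => v'uv u'uv.
  have := set21 u v; have := set22 u v; rewrite e !inE => vuv' uuv'.
  move: v'uv u'uv; rewrite !inE => /orP[] /eqP ev /orP[] /eqP eu; subst => //.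
  - by move: vuv'; rewrite orbb => /eqP <-.
  - by rewrite Ds.
  - by move: uuv'; rewrite orbb => /eqP <-.
apply: leq_trans (leq_bigmax u).
by apply: (leq_bigmax_cond v (F := fun v => (D u v).-1)); rewrite pE.
Qed.

Lemma var_pairE p : is_var_pair p ->
  exists2 uv : var * var, uv.1 != uv.2 & val p = [set Var uv.1; Var uv.2].
Proof.
case: p => A /= Acard; rewrite /is_var_pair /= => sA.
have /cards2P[a [b [ab Aab]]] := Acard.
have /imsetP[u _ au] : a \in [set Var v | v : var] by apply: (subsetP sA); rewrite Aab set21.
have /imsetP[v _ bv] : b \in [set Var v | v : var] by apply: (subsetP sA); rewrite Aab set22.
by exists (u, v); rewrite /= ?Aab ?au ?bv //; move: ab; rewrite au bv VarK.
Qed.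

Lemma centre_separator_of D c : (forall u v, D u v = D v u) ->
    (forall u v w : var, u != v -> u != w -> v != w ->
      (D (Var u) (Var v)).-1 + (D (Var u) (Var w)).-1 <= c) ->
  centre (separator_of D) <= c.
Proof.
move=> Ds Dc; apply/bigmax_leqP=> p /var_pairE[[u v] /= uv pE].
apply/bigmax_leqP=> q /andP[/var_pairE[[u' v'] /= uv' qE] pq].
rewrite (separator_ofE Ds pE) (separator_ofE Ds qE).
have npq : [set Var u; Var v] != [set Var u'; Var v'].
  apply: contra pq => /eqP e; apply/eqP/val_inj.
  exact: etrans pE (etrans e (esym qE)).
have [eu|uu'] := eqVneq u u'.
  by subst u'; apply: Dc => //; apply: contra npq => /eqP ->.
have [ev|uv''] := eqVneq u v'.
  by subst v'; rewrite (Ds (Var u')); apply: Dc; rewrite // 1?eq_sym //;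
     apply: contra npq => /eqP ->; rewrite setUC.
have [ev|vu'] := eqVneq v u'.
  by subst u'; rewrite (Ds (Var u)); apply: Dc; rewrite // eq_sym.
have [ev|vv'] := eqVneq v v'.
  by subst v'; rewrite (Ds (Var u)) (Ds (Var u')); apply: Dc; rewrite // eq_sym.
(* Two disjoint pairs would need four variables. *)
by exfalso; clear - uv uv' uu' uv'' vu' vv'; case: u v u' v' uv uv' uu' uv'' vu' vv' => [] [] [] [].
Qed.

Lemma border_separator_of D b : (forall u v, D u v = D v u) ->
    (D Min Max).-1 <= b ->
    (forall u v : var, (D Min (Var u)).-1 + (D (Var v) Max).-1 <= b) ->
  border (separator_of D) <= b.
Proof.
move=> Ds Dm Db; rewrite /border geq_max (@separator_ofE _ _ Min Max) // Dm /=.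
apply/bigmax_leqP=> u _; apply/bigmax_leqP=> v _.
by rewrite (@separator_ofE _ _ Min (Var u)) // (@separator_ofE _ _ (Var v) Max).
Qed.

(** Interpretations told apart by [psi] are not similar. Where [close] fails, either the order types
    differ, or the distances differ and the smaller one is below the threshold, hence at most
    [D - 1]. *)
Lemma is_separator_of A B D psi : (forall u v, D u v = D v u) ->
    (forall I J, sim D I J -> satI I psi -> satI J psi) -> separates A B psi ->
  is_separator A B (separator_of D).
Proof.
move=> Ds inv [Apsi Bpsi] I J AI BJ.
have nsim : ~~ sim D I J by apply/negP=> /inv /(_ (Apsi _ AI)); exact: Bpsi.
have [u [v nclose]] : exists u v,
    ~~ close (D u v) (valI I v - valI I u)%R (valI J v - valI J u)%R.
  move: nsim; rewrite /sim negb_forall => /existsP[u]; rewrite negb_forall => /existsP[v h].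
  by exists u, v.
have uv : u != v.
  by apply: contra nclose => /eqP ->; rewrite !subrr /close eqxx orbT.
exists u, v, uv; rewrite (@separator_ofE _ _ u v) // /lt_type /dist.
move: nclose; move: (D u v) (valI I u) (valI I v) (valI J u) (valI J v) => d a a' e e'.
rewrite /close => h.
case: (ltgtP a a') => aa'; case: (ltgtP e e') => ee'; (try by left); right; lia.
Qed.

Lemma ex_table t psi : 0 < t -> in_C3 t psi -> exists D c b,
  [/\ forall u v, D u v = D v u,
      forall I J, sim D I J -> satI I psi -> satI J psi,
      forall u v w : var, u != v -> u != w -> v != w ->
        (D (Var u) (Var v)).-1 + (D (Var u) (Var w)).-1 <= c,
      (D Min Max).-1 <= b /\
      forall u v : var, (D Min (Var u)).-1 + (D (Var v) Max).-1 <= b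
    & c ^ 2 + b <= (t * fsize psi) ^ 2].
Proof.
move=> t_gt0 psi_t; have [t1|t1] := leqP t 1.
  have t1E : t = 1 by apply/eqP; rewrite eqn_leq t1.
  subst t; have [Sig [D [S [c [b [[sz Ds irr inv] [[Dc Dm Db] le _ _]]]]]]] := thin_invP psi_t.
  (* The atoms still outside a quantifier are folded in here. Even on an empty entry they raise the
     separator only to 1, so the centre grows by at most their number. *)
  exists (link D Sig), (c + size Sig), b; split.
  - exact: link_sym.
  - by move=> I J /sim_link/andP[]; exact: inv.
  - move=> u v w uv uw vw; have := Dc _ _ _ uv uw vw; rewrite !cost0 /link.
    have : (0 < mult Sig (Var u) (Var v)) + (0 < mult Sig (Var u) (Var w)) <= size Sig.
      rewrite (size_mult uv uw vw (distinct_vars uv uw vw) irr).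
      by case: (mult Sig (Var u) (Var v)) => [|m]; case: (mult Sig (Var u) (Var w)) => [|n]; lia.
    by case: (0 < mult _ _ _); case: (0 < mult _ _ _); lia.
  - by split=> [|u v]; rewrite !link_border ?orbT.
  - by rewrite mul1n sz (addnC (size Sig)) -[b]addn0; apply: sqr_add_bound; rewrite ?addn0.
have [D [c [b [Ds inv [Dc Dm Db] le]]]] := thick_invP t1 psi_t.
exists D, c, b; split=> //; first by move=> I J s; apply: inv.
move=> u v w uv uw vw; apply: leq_trans (Dc _ _ _ uv uw vw).
have := costP (t - 2) (D (Var u) (Var v)); have := costP (t - 2) (D (Var u) (Var w)).
by lia.
Qed.

Local Open Scope ring_scope.

Theorem theorem6 (R : rcfType) (t : nat) (psi : formula)
    (A B : interp -> Prop) (delta : separator)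
    (t_ge1 : (1 <= t)%N)
    (psi_C3t : in_C3 t psi)
    (AB_psi : separates A B psi)
    (delta_min : minimal_separator R A B delta) :
  weight R delta / t%:R <= (fsize psi)%:R.
Proof.
have [D [c [b [Ds inv Dc [Dm Db] cb]]]] := ex_table t_ge1 psi_C3t.
rewrite ler_pdivrMr ?ltr0n // -natrM mulnC.
apply: le_trans (delta_min.2 _ (is_separator_of Ds inv AB_psi)) _.
rewrite /weight -[leRHS]ger0_norm ?ler0n // -sqrtr_sqr ler_wsqrtr //.
rewrite -!natrX -natrD ler_nat; apply: leq_trans cb.
by rewrite leq_add ?leq_sqr ?border_separator_of ?centre_separator_of.
Qed.
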